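(* Let $f:\mathbb{R}\to\mathbb{R}$ be a Lipschitz continuous, 1-periodic function which is exactly 1-periodic, in the sense that $f(\cdot-\theta)\neq f(\cdot-\theta^* )$ on a set of positive Lebesgue measure whenever $\theta\neq\theta^*\bmod 1$. Let $Z_1,\dots,Z_n$ be iid with an even density $\phi$ and distribution function $\Phi$, and observe $Y_i=f(x_i-\theta^* )+Z_i$, $i=1,\dots,n$, where $x_i:=i/n$. Let $\Phi_2(t):=\int_{-\infty}^\infty\Phi(t+z)\phi(z)\,dz$ and $$M(\theta):=\int_0^1\!\!\int_0^1 \Phi_2\big(f(x_0)-f(x)\big)\, f(x_0+\theta^*-\theta)\,dx\,dx_0,$$ and assume that $\theta^*$ is the unique maximum point of $M$ modulo 1 (i.e. $M(\theta)<M(\theta^* )$ whenever $\theta\neq\theta^*\bmod 1$). Let $R_i$ be the rank of $Y_i$ among $Y_1,\dots,Y_n$ and let $\hat\theta_n$ be a maximizer over $\theta$ of $\widehat M_n(\theta):=\frac1n\sum_{i=1}^n\frac{R_i}{n}f(x_i-\theta)$. Then $\hat\theta_n\to\theta^*$ in probability as $n\to\infty$ (convergence understood modulo 1, i.e. the distance in $\mathbb{R}/\mathbb{Z}$ between $\hat\theta_n$ and $\theta^*$ tends to 0 in probability).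
   Context: $\hat\theta_n$ is the rank-based (R-)estimator of the shift; since $f$ and $\widehat M_n$ are 1-periodic, the shift is identified only modulo 1. *)

(* Defs.v *)
From HB Require Import structures.
From mathcomp Require Import all_boot all_order all_algebra.
From mathcomp Require Import all_classical all_reals all_analysis.
Set Implicit Arguments. Unset Strict Implicit. Unset Printing Implicit Defensive.
Import Order.TTheory GRing.Theory Num.Theory.
Import numFieldNormedType.Exports.
Local Open Scope classical_set_scope.
Local Open Scope ring_scope.

Section Defs.
Variable R : realType.
Local Notation leb := (@lebesgue_measure R).

Definition circ_dist (a b : R) : R :=
  let t := (a - b) - (Num.floor (a - b))%:~R in Num.min t (1 - t).

Definition cdf (phi : R -> R) (t : R) : R :=
  \int[leb]_(z in `]-oo, t]) phi z.

Definition Phi2 (phi : R -> R) (t : R) : R :=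
  \int[leb]_(z in [set: R]) (cdf phi (t + z) * phi z).

Definition Mpop (phi f : R -> R) (thstar th : R) : R :=
  \int[leb]_(x0 in `[0, 1]) \int[leb]_(x in `[0, 1])
     (Phi2 phi (f x0 - f x) * f (x0 + thstar - th)).

Definition rank (n : nat) (Y : nat -> R) (i : nat) : nat :=
  count (fun j => Y j <= Y i) (iota 1 n).

Definition Mhat (n : nat) (Y : nat -> R) (f : R -> R) (th : R) : R :=
  n%:R^-1 * \sum_(1 <= i < n.+1)
     ((rank n Y i)%:R / n%:R * f (i%:R / n%:R - th)).

End Defs.

(* Main.v *)
Require Import Defs.
From HB Require Import structures.
From mathcomp Require Import all_boot all_order all_algebra.
From mathcomp Require Import all_classical all_reals all_analysis.
From mathcomp Require Import measurable_realfun.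
From mathcomp Require Import zify ring lra.
Import Order.TTheory GRing.Theory Num.Theory.
Import numFieldNormedType.Exports.
Local Open Scope classical_set_scope.
Local Open Scope ring_scope.

(** The rank of Y_i is the sum over j of the indicators of {Y_j <= Y_i}, so that
    hat M_n(theta) is a weighted U-statistic of order two. Events attached to
    disjoint pairs of indices are independent, hence its variance is O(1/n) and
    hat M_n(theta) is close in probability to its mean. Off the diagonal the
    probability of {Y_j <= Y_i} is Phi_2 of the difference of the means of Y_i
    and Y_j, so this mean is, up to O(1/n), a Riemann sum for M(theta), and
    Phi_2 is uniformly continuous. Both hat M_n and M are 1-periodic and share
    the Lipschitz constant of f, so a finite net of [0, 1] makes the convergence
    uniform. By compactness M(theta) stays below M(thstar) by a fixed gap when
    theta is at distance more than eps from thstar, so that no such theta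
    maximizes hat M_n once hat M_n is uniformly close to M. *)

Lemma Rintegral_probability_cst (d : measure_display) (T : measurableType d)
    (R : realType) (P : probability T R) (c : R) : \int[P]_w c = c.
Proof.
rewrite Rintegral_cst// [X in fine X](_ : _ = 1%E) ?mulr1//.
exact: probability_setT.
Qed.

(** * Independence of events attached to disjoint pairs *)

(* Keeping a fixed event E along allows the lemma to be used twice: first with E
   a rectangle in another pair of variables, then with E arbitrary in that pair. *)
Lemma measure_pair_event (d : measure_display) (T : measurableType d)
    (R : realType) (P : probability T R)
    (d' : measure_display) (T' : measurableType d')
    (X Y : {mfun T >-> T'}) (E : set T) :
  measurable E ->
  (forall A B : set T', measurable A -> measurable B ->
    P (X @^-1` A `&` Y @^-1` B `&` E)
    = (P (X @^-1` A) * P (Y @^-1` B) * P E)%E) ->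
  forall C : set (T' * T'), measurable C ->
    P ((fun w => (X w, Y w)) @^-1` C `&` E)
    = ((distribution P X \x distribution P Y) C * P E)%E.
Proof.
move=> mE XYE C mC.
have mXY : measurable_fun setT (fun w => (X w, Y w)).
  by apply/measurable_fun_pairP; split; exact: measurable_funP.
have fE : P E \is a fin_num by exact: fin_num_measure.
pose k : {nonneg R} := NngNum (fine_ge0 (measure_ge0 P E)).
have kE : (k%:num)%:E = P E by rewrite /= fineK.
(* The restriction of [P] to [E], pushed forward by the pair, and the product of the two laws, with
   the factor [P E] put on the first marginal, agree on rectangles; uniqueness of product measures
   identifies them. *)
pose m' : {measure set (T' * T') -> \bar R} :=
  pushforward (mrestr P mE) (fun w => (X w, Y w)).
pose m1 : {finite_measure set T' -> \bar R} := mscale k (distribution P X).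
rewrite -[LHS]/(m' mXY C).
rewrite -(@product_measure_unique _ _ _ _ _ m1 (distribution P Y) (m' mXY))//.
- rewrite /product_measure1 /= ge0_integral_mscale//.
    by rewrite kE muleC.
  exact: measurable_fun_xsection.
- move=> A B mA mB; rewrite /= /mscale /= fineK//.
  by rewrite -muleA muleC -XYE.
Qed.

Section independent_family.
Context (d : measure_display) (T : measurableType d) (R : realType).
Context (P : probability T R) (d' : measure_display) (T' : measurableType d').
Context (n : nat) (X : nat -> {mfun T >-> T'}).
Hypothesis Xindep : forall B : nat -> set T', (forall i, measurable (B i)) ->
  P [set w | forall i, (1 <= i <= n)%N -> X i w \in B i] =
  (\prod_(1 <= i < n.+1) P (X i @^-1` B i))%E.

(** Taking the full set at every index outside [s] only adds factors 1 to the product. *)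
Lemma independent_subfamily (s : seq nat) (B : nat -> set T') :
  uniq s -> {in s, forall i, (1 <= i <= n)%N} -> (forall i, measurable (B i)) ->
  P [set w | forall i, i \in s -> B i (X i w)] =
  (\prod_(i <- s) P (X i @^-1` B i))%E.
Proof.
move=> us sn mB.
pose B' i := if i \in s then B i else setT.
have := Xindep B'.
have -> : [set w | forall i, (1 <= i <= n)%N -> X i w \in B' i] =
          [set w | forall i, i \in s -> B i (X i w)].
  apply/seteqP; split=> w /= h i.
    by move=> is_; have := h _ (sn _ is_); rewrite /B' is_ inE.
  by move=> _; rewrite /B'; case: ifPn => [/h|]; rewrite inE.
move=> ->; last by move=> i; rewrite /B'; case: ifP.
rewrite (bigID (mem s))/= [X in (_ * X)%E]big1 ?mule1; last first.
  by move=> i /negbTE si; rewrite /B' si preimage_setT probability_setT.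
rewrite -big_filter (perm_big s).
  by apply: eq_big_seq => i si; rewrite /B' si.
apply: uniq_perm => //; first by rewrite filter_uniq// iota_uniq.
move=> i; rewrite mem_filter mem_index_iota ltnS.
by case: (boolP (i \in s)) => //= /sn ->.
Qed.

Lemma independent_pair_rectangle (i j : nat) (A B : set T') :
  (1 <= i <= n)%N -> (1 <= j <= n)%N -> i != j ->
  measurable A -> measurable B ->
  P (X i @^-1` A `&` X j @^-1` B) = (P (X i @^-1` A) * P (X j @^-1` B))%E.
Proof.
move=> i1 j1 ij mA mB.
have ji : (j == i) = false by rewrite eq_sym (negbTE ij).
have := @independent_subfamily [:: i; j] (fun m => if m == i then A else B).
rewrite !big_cons big_nil mule1 eqxx ji => <-.
- congr (P _); apply/seteqP; split=> w /=.
    by move=> [Aw Bw] m; rewrite !inE => /orP[]/eqP->; rewrite ?eqxx ?ji.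
  move=> h; split; first by have := h i; rewrite eqxx inE eqxx; exact.
  by have := h j; rewrite ji !inE eqxx orbT; exact.
- by rewrite /= inE ij.
- by move=> m; rewrite !inE => /orP[]/eqP->.
- by move=> m; case: ifP.
Qed.

Lemma independent_quadruple_rectangle (i j k l : nat) (A B C D : set T') :
  (1 <= i <= n)%N -> (1 <= j <= n)%N -> (1 <= k <= n)%N -> (1 <= l <= n)%N ->
  uniq [:: i; j; k; l] ->
  measurable A -> measurable B -> measurable C -> measurable D ->
  P (X i @^-1` A `&` X j @^-1` B `&` (X k @^-1` C `&` X l @^-1` D)) =
  (P (X i @^-1` A) * P (X j @^-1` B) * (P (X k @^-1` C) * P (X l @^-1` D)))%E.
Proof.
move=> i1 j1 k1 l1 u mA mB mC mD.
have := u; rewrite /= !inE !negb_or => /and4P[/and3P[ij ik il] /andP[jk jl] kl _].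
have ne (a b : nat) : a != b -> (b == a) = false by rewrite eq_sym => /negbTE.
have [ji ki li] := And3 (ne _ _ ij) (ne _ _ ik) (ne _ _ il).
have [kj lj lk] := And3 (ne _ _ jk) (ne _ _ jl) (ne _ _ kl).
have := @independent_subfamily [:: i; j; k; l] (fun m =>
  if m == i then A else if m == j then B else if m == k then C else D).
rewrite !big_cons big_nil mule1 !eqxx ji ki kj li lj lk -muleA => <-//.
- congr (P _); apply/seteqP; split=> w /=.
    move=> [[Aw Bw] [Cw Dw]] m; rewrite !inE => /or4P[]/eqP->;
    by rewrite ?eqxx ?ji ?ki ?kj ?li ?lj ?lk.
  move=> h; split; split.
  + by have := h i; rewrite eqxx !inE eqxx; exact.
  + by have := h j; rewrite ji eqxx !inE eqxx orbT; exact.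
  + by have := h k; rewrite ki kj eqxx !inE eqxx !orbT; exact.
  + by have := h l; rewrite li lj lk !inE eqxx !orbT; exact.
- by move=> m; rewrite !inE => /or4P[]/eqP->.
- by move=> m; case: ifP => // _; case: ifP => // _; case: ifP.
Qed.

Lemma measurable_pair_preimage (i j : nat) (C : set (T' * T')) :
  measurable C -> measurable ((fun w => (X i w, X j w)) @^-1` C).
Proof.
move=> mC; rewrite -[_ @^-1` _]setTI.
have : measurable_fun setT (fun w => (X i w, X j w)).
  by apply/measurable_fun_pairP; split; exact: measurable_funP.
exact.
Qed.

Lemma independent_pair_law (i j : nat) (C : set (T' * T')) :
  (1 <= i <= n)%N -> (1 <= j <= n)%N -> i != j -> measurable C ->
  P ((fun w => (X i w, X j w)) @^-1` C) =
  (distribution P (X i) \x distribution P (X j))%E C.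
Proof.
move=> i1 j1 ij mC.
have -> : P ((fun w => (X i w, X j w)) @^-1` C) =
          P ((fun w => (X i w, X j w)) @^-1` C `&` setT) by rewrite setIT.
rewrite (measure_pair_event _ _ _ _ _ _ _ _ setT)//.
  by rewrite probability_setT mule1.
move=> A B mA mB; rewrite setIT probability_setT mule1.
exact: independent_pair_rectangle.
Qed.

(** Rectangles are widened to arbitrary sets one pair at a time: first [C], against a rectangle in
    the second pair, then [D], against the event of [C]. *)
Lemma independent_disjoint_pairs (i j k l : nat) (C D : set (T' * T')) :
  (1 <= i <= n)%N -> (1 <= j <= n)%N -> (1 <= k <= n)%N -> (1 <= l <= n)%N ->
  uniq [:: i; j; k; l] -> measurable C -> measurable D ->
  P ((fun w => (X i w, X j w)) @^-1` C `&` (fun w => (X k w, X l w)) @^-1` D) =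
  (P ((fun w => (X i w, X j w)) @^-1` C) *
   P ((fun w => (X k w, X l w)) @^-1` D))%E.
Proof.
move=> i1 j1 k1 l1 u mC mD.
have [ij kl] : i != j /\ k != l.
  by move: u; rewrite /= !inE !negb_or => /and4P[/and3P[-> _ _] _ -> _].
have step A' B' : measurable A' -> measurable B' ->
    P ((fun w => (X i w, X j w)) @^-1` C `&` (X k @^-1` A' `&` X l @^-1` B')) =
    ((distribution P (X i) \x distribution P (X j)) C *
     P (X k @^-1` A' `&` X l @^-1` B'))%E.
  move=> mA' mB'; apply: measure_pair_event => //.
    by apply: measurableI; rewrite -[_ @^-1` _]setTI; exact: measurable_funP.
  move=> A B mA mB; rewrite independent_quadruple_rectangle//.
  by rewrite (independent_pair_rectangle k l).
have mCij := measurable_pair_preimage i j _ mC.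
rewrite setIC (measure_pair_event _ _ _ P _ _ (X k) (X l) _ mCij)//; last first.
  move=> A B mA mB; rewrite setIC step// -independent_pair_law// muleC.
  by rewrite independent_pair_rectangle.
by rewrite -!independent_pair_law// muleC.
Qed.

End independent_family.

(** * Densities, distribution functions and Phi_2 *)

(** Functions with equal integrals over all measurable sets agree almost everywhere, so [phi] is a
    version of the Radon-Nikodym derivative of [nu]. *)
Lemma integral_density (d : measure_display) (T : measurableType d)
    (R : realType) (mu : {sigma_finite_measure set T -> \bar R})
    (nu : probability T R) (phi : T -> R) :
  measurable_fun setT phi ->
  (forall B, measurable B -> nu B = (\int[mu]_(x in B) (phi x)%:E)%E) ->
  forall g : T -> \bar R, nu.-integrable setT g ->
  (\int[nu]_x g x = \int[mu]_x (g x * (phi x)%:E))%E.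
Proof.
move=> mphi nuE g ig.
have numu : nu `<< mu.
  apply/null_content_dominatesP => A mA muA0; rewrite nuE//.
  apply: null_set_integral => //; apply/measurable_EFinP.
  exact: measurable_funTS.
have mg := measurable_int _ ig.
rewrite -(Radon_Nikodym_change_of_variables numu)//.
apply: ae_eq_integral => //.
- by apply: emeasurable_funM => //; apply: (measurable_int mu);
    apply: Radon_Nikodym_integrable.
- by apply: emeasurable_funM => //; exact/measurable_EFinP.
- apply: ae_eqe_mul2l; apply: integral_ae_eq => //.
  + exact: Radon_Nikodym_integrable.
  + exact/measurable_EFinP.
  + by move=> A _ mA; rewrite -Radon_Nikodym_integral// -nuE.
Qed.

(* Laws live on [measurableTypeR R], the measurable type carrying
   [lebesgue_measure]; its display differs from that of the default measurable
   structure of [R]. *)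
Section density.
Context (R : realType) (phi : R -> R).
Local Notation leb := (@lebesgue_measure R).
Hypothesis phi_ge0 : forall x, 0 <= phi x.
Hypothesis mphi : measurable_fun [set: R] phi.

Section law.
Variable nu : probability (measurableTypeR R) R.
Hypothesis nuE : forall B : set R, measurable B ->
  nu B = (\int[leb]_(x in B) (phi x)%:E)%E.

Lemma cdf_measure (t : R) : (Defs.cdf phi t)%:E = nu `]-oo, t]%classic.
Proof. by rewrite /Defs.cdf /Rintegral -nuE// fineK// fin_num_measure. Qed.

Lemma cdf_ge0 (t : R) : 0 <= Defs.cdf phi t.
Proof. by rewrite -lee_fin cdf_measure. Qed.

Lemma cdf_le1 (t : R) : Defs.cdf phi t <= 1.
Proof. by rewrite -lee_fin cdf_measure probability_le1. Qed.

Lemma cdf_nondecreasing : nondecreasing (Defs.cdf phi).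
Proof.
move=> s t st; rewrite -lee_fin !cdf_measure le_measure ?inE//.
by apply: subset_itvl; rewrite bnd_simp.
Qed.

Lemma measurable_cdf : measurable_fun [set: R] (Defs.cdf phi).
Proof. apply: nondecreasing_measurable => //; exact: cdf_nondecreasing. Qed.

(** Absolute continuity of the integral of [phi] bounds the mass of every short interval, wherever
    it lies. By monotonicity this one-sided bound amounts to uniform continuity. *)
Lemma cdf_modulus (e : R) : 0 < e -> exists2 del : R, 0 < del &
  forall s t : R, s <= t -> t - s < del -> Defs.cdf phi t <= Defs.cdf phi s + e.
Proof.
move=> e0.
have iphi : leb.-integrable setT (EFin \o phi).
  apply/integrableP; split; first exact/measurable_EFinP.
  under eq_integral do rewrite /= ger0_norm//.
  by rewrite -nuE// probability_setT ltry.
have [del [del0 H]] := integral_normr_continuous iphi e0.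
exists del => // s t st std.
rewrite -lee_fin EFinD !cdf_measure.
have -> : `]-oo, t]%classic = `]-oo, s]%classic `|` `]s, t]%classic.
  by rewrite -itv_bndbnd_setU// bnd_simp.
rewrite measureU//; last first.
  rewrite -subset0 => x [/=]; rewrite !in_itv/= => xs /andP[sx _].
  by move: sx; rewrite ltNge xs.
have nuI : nu `]s, t]%classic = (\int[leb]_(x in `]s, t]) (phi x)%:E)%E.
  by apply: nuE; exact: measurable_itv.
apply: leeD2l; rewrite [leLHS]nuI.
have lt_del : (leb `]s, t]%classic < del%:E)%E.
  by rewrite lebesgue_measure_itv/=; case: ifP => _; rewrite -?EFinB lte_fin.
have /ltW := H _ (measurable_itv _) lt_del; rewrite /Rintegral -lee_fin.
under eq_integral do rewrite ger0_norm//.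
by rewrite -nuI fineK// fin_num_measure.
Qed.

Lemma integrable_cdf (c : R) :
  nu.-integrable setT (fun z => (Defs.cdf phi (c + z))%:E).
Proof.
apply: measurable_bounded_integrable => //.
- by rewrite -ge0_fin_numE ?measure_ge0// fin_num_measure.
- by apply: measurableT_comp; [exact: measurable_cdf|exact: measurable_funD].
- exists 1; split => // M M1 z _ /=; rewrite ger0_norm ?cdf_ge0//.
  exact: le_trans (cdf_le1 _) (ltW M1).
Qed.

(** Written as an expectation under a probability law, [Phi2] inherits the bounds, the monotonicity
    and the modulus of [cdf]. *)
Lemma Phi2E (c : R) : Phi2 phi c = \int[nu]_z Defs.cdf phi (c + z).
Proof.
rewrite /Phi2 /Rintegral; congr fine; symmetry.
have H := integral_density _ _ _ leb nu phi mphi nuE _ (integrable_cdf c). exact H.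
Qed.

Lemma Phi2_ge0 (c : R) : 0 <= Phi2 phi c.
Proof. by rewrite Phi2E; apply: Rintegral_ge0 => z _; exact: cdf_ge0. Qed.

Lemma Phi2_le1 (c : R) : Phi2 phi c <= 1.
Proof.
rewrite Phi2E -[leRHS](Rintegral_probability_cst _ _ _ nu).
apply: le_Rintegral => //; first exact: integrable_cdf.
  exact: finite_measure_integrable_cst.
by move=> z _; exact: cdf_le1.
Qed.

Lemma Phi2_modulus (e : R) : 0 < e -> exists2 del : R, 0 < del &
  forall s t : R, `|s - t| < del -> `|Phi2 phi s - Phi2 phi t| <= e.
Proof.
move=> e0; have [del del0 H] := cdf_modulus e e0; exists del => // s t.
wlog st : s t / s <= t => [W|].
  have [st|/ltW ts] := leP s t; first exact: (W s t st).
  rewrite (distrC s) (distrC (Phi2 phi s)); exact: (W t s ts).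
have Hst a b : b - a < del -> a <= b -> Phi2 phi b <= Phi2 phi a + e.
  move=> ba ab; have ic := finite_measure_integrable_cst nu e measurableT.
  rewrite !Phi2E -[e in leRHS](Rintegral_probability_cst _ _ _ nu).
  rewrite -(RintegralD measurableT (integrable_cdf a) ic).
  apply: (le_Rintegral measurableT (integrable_cdf b)).
    exact: (integrableD measurableT (integrable_cdf a) ic).
  move=> z _; apply: H; first by rewrite lerD2r.
  by rewrite opprD addrACA subrr addr0.
have mono : Phi2 phi s <= Phi2 phi t.
  rewrite !Phi2E.
  apply: (le_Rintegral measurableT (integrable_cdf _) (integrable_cdf _)).
  by move=> z _; apply: cdf_nondecreasing; rewrite lerD2r.
rewrite distrC ger0_norm ?subr_ge0// => std.
rewrite distrC ger0_norm ?subr_ge0//.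
by rewrite lerBlDl Hst.
Qed.

End law.

(** The section of the half-plane at z is the half-line up to c + z. The laws are kept separate
    because they come from two noise variables that share only their density. *)
Lemma product_halfplane_Phi2 (nu1 nu2 : probability (measurableTypeR R) R) (c : R) :
  (forall B : set R, measurable B ->
     nu1 B = (\int[leb]_(x in B) (phi x)%:E)%E) ->
  (forall B : set R, measurable B ->
     nu2 B = (\int[leb]_(x in B) (phi x)%:E)%E) ->
  (nu1 \x nu2)%E [set p | p.2 <= c + p.1] = (Phi2 phi c)%:E.
Proof.
move=> nu1E nu2E; rewrite (Phi2E nu1)// /product_measure1 /= /Rintegral fineK.
  apply: eq_integral => z _ /=.
  rewrite (cdf_measure nu2)//; congr (nu2 _).
  by apply/seteqP; split=> x; rewrite /xsection /= inE in_itv.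
apply: integrable_fin_num => //; exact: integrable_cdf.
Qed.

End density.

(** * Deviation of weighted sums of indicators *)

Section second_moment.
Context (d : measure_display) (T : measurableType d) (R : realType).
Context (P : probability T R).

Lemma integrable_bounded_probability (g : T -> R) (M : R) :
  measurable_fun setT g -> (forall w, `|g w| <= M) ->
  P.-integrable setT (EFin \o g).
Proof.
move=> mg gM; apply: measurable_bounded_integrable => //.
  by rewrite -ge0_fin_numE ?measure_ge0// fin_num_measure.
exists M; split => [|K MK w _]; first exact: num_real.
exact: le_trans (gM w) (ltW MK).
Qed.

Lemma Rintegral_sum (I : Type) (r : seq I) (F : I -> T -> R) :
  (forall i, P.-integrable setT (EFin \o F i)) ->
  \int[P]_w (\sum_(i <- r) F i w) = \sum_(i <- r) \int[P]_w F i w.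
Proof.
move=> iF; elim: r => [|i r IH].
  rewrite big_nil -[RHS](_ : \int[P]_w 0 = _).
    by apply: eq_Rintegral => w _; rewrite big_nil.
  by rewrite Rintegral_cst// mul0r.
rewrite big_cons -IH -RintegralD//.
  by apply: eq_Rintegral => w _; rewrite big_cons.
have : P.-integrable setT (fun w => (\sum_(j <- r) (F j w)%:E)%E).
  by apply: integrable_sum => // j _; exact: iF.
by apply: eq_integrable => // w _ /=; rewrite sumEFin.
Qed.

Lemma Rintegral_probability_indic (A : set T) : measurable A ->
  \int[P]_w \1_A w = fine (P A).
Proof. by move=> mA; rewrite /Rintegral integral_indic// setIT. Qed.

(* [dep] need only contain the pairs of events that are not independent: the
   covariances of all the other pairs vanish. *)
Lemma second_moment_bound (I : finType) (E : I -> set T) (p c : I -> R)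
    (B : R) (dep : rel I) :
  (forall a, measurable (E a)) -> (forall a, P (E a) = (p a)%:E) ->
  (forall a, `|c a| <= B) ->
  (forall a b, ~~ dep a b -> P (E a `&` E b) = (p a * p b)%:E) ->
  \int[P]_w (\sum_a c a * (\1_(E a) w - p a)) ^+ 2 <=
    B ^+ 2 * \sum_a \sum_b (dep a b)%:R.
Proof.
move=> mE pE cB indep.
have p0 a : 0 <= p a by rewrite -lee_fin -pE.
have p1 a : p a <= 1 by rewrite -lee_fin -pE probability_le1.
pose D a w : R := \1_(E a) w - p a.
have mD a : measurable_fun setT (D a) by apply: measurable_funB.
have D1 a w : `|D a w| <= 1.
  rewrite /D indicE ler_norml; have := p0 a; have := p1 a.
  by case: (w \in E a) => /=; rewrite ?mulr1n ?mulr0n; lra.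
pose G (ab : I * I) w := c ab.1 * D ab.1 w * (c ab.2 * D ab.2 w).
have cD a w : `|c a * D a w| <= B.
  by rewrite normrM -[B]mulr1 ler_pM.
have GB ab w : `|G ab w| <= B ^+ 2 by rewrite normrM expr2 ler_pM.
have mG ab : measurable_fun setT (G ab).
  by apply: measurable_funM; apply: measurable_funM.
have iG ab := integrable_bounded_probability _ _ (mG ab) (GB ab).
rewrite (_ : (fun w => _) = fun w => \sum_ab G ab w); last first.
  by apply/funext => w; rewrite expr2 big_distrlr pair_big.
rewrite Rintegral_sum// pair_big mulr_sumr; apply: ler_sum => -[a b] _ /=.
(* A pair that may be dependent is bounded crudely by [B ^+ 2]. *)
have [_|/indep Eab] := boolP (dep a b).
  rewrite mulr1; apply: (@le_trans _ _ (\int[P]_w (B ^+ 2))).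
    apply: le_Rintegral => //; first exact: finite_measure_integrable_cst.
    by move=> w _; rewrite (le_trans (ler_norm _)).
  by rewrite Rintegral_probability_cst.
rewrite mulr0.
have i1 (A : set T) : measurable A -> P.-integrable setT (EFin \o \1_A).
  move=> mA; apply: (integrable_bounded_probability _ 1) => // w.
  by rewrite indicE; case: (w \in A); rewrite ?normr1 ?normr0.
(* Once the product of centred indicators is expanded, its integral is the probability of the
   intersection minus [p a * p b], which is 0. *)
rewrite (_ : (fun w => _) = fun w => c a * c b * (\1_(E a `&` E b) w
   - p b * \1_(E a) w - p a * \1_(E b) w + p a * p b)); last first.
  by apply/funext => w; rewrite /G /= /D indicI /=; ring.
have iZ k A (mA : measurable A) :
    P.-integrable setT (EFin \o (fun w => k * \1_A w)).
  apply: (integrable_bounded_probability _ `|k|) => [|w].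
    by apply: measurable_funM.
  by rewrite indicE; case: (w \in A); rewrite ?mulr1 ?mulr0 ?normr0.
have mab := measurableI _ _ (mE a) (mE b).
have ic k := finite_measure_integrable_cst P k measurableT.
have iB1 := integrableB measurableT (i1 _ mab) (iZ (p b) _ (mE a)).
have iB2 := integrableB measurableT iB1 (iZ (p a) _ (mE b)).
have iB3 := integrableD measurableT iB2 (ic (p a * p b)).
rewrite (RintegralZl _ measurableT iB3) (RintegralD measurableT iB2 (ic _)).
rewrite (RintegralB measurableT iB1 (iZ _ _ (mE b))).
rewrite (RintegralB measurableT (i1 _ mab) (iZ _ _ (mE a))).
rewrite !(RintegralZl _ measurableT (i1 _ _))//.
rewrite !Rintegral_probability_indic// Rintegral_probability_cst Eab !pE /=.
by rewrite [X in _ * X](_ : _ = 0) ?mulr0//; ring.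
Qed.

(** Integrates the inequality eta^2 1_A <= S^2; the bound [M] gives integrability. *)
Lemma chebyshev_second_moment (S : T -> R) (M eta : R) :
  measurable_fun setT S -> (forall w, `|S w| <= M) -> 0 < eta ->
  (P [set w | (eta <= `|S w|)%R] <= ((\int[P]_w (S w) ^+ 2) / eta ^+ 2)%:E)%E.
Proof.
move=> mS SM eta0; set A := [set w | _].
have mA : measurable A.
  rewrite -[A]setTI; apply: measurable_fun_le => //.
  exact: measurableT_comp.
have M0 : 0 <= M by rewrite (le_trans (normr_ge0 _) (SM point)).
rewrite -[leLHS]fineK ?fin_num_measure// lee_fin ler_pdivlMr ?exprn_gt0//.
rewrite -Rintegral_probability_indic// mulrC.
have i1 : P.-integrable setT (EFin \o \1_A).
  apply: (integrable_bounded_probability _ 1) => // w.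
  by rewrite indicE; case: (w \in A); rewrite ?normr1 ?normr0.
rewrite -(RintegralZl _ measurableT i1); apply: le_Rintegral => //.
- apply: (integrable_bounded_probability _ (eta ^+ 2)).
    exact: measurable_funM.
  move=> w; rewrite normrM ger0_norm ?sqr_ge0// ler_piMr ?sqr_ge0//.
  by rewrite indicE; case: (w \in A); rewrite ?normr1 ?normr0.
- apply: (integrable_bounded_probability _ (M ^+ 2)).
    exact: measurable_funX.
  by move=> w; rewrite normrX lerXn2r ?nnegrE.
- move=> w _; rewrite indicE.
  case: (boolP (w \in A)) => [|_]; rewrite ?mulr0 ?sqr_ge0// inE /A /= mulr1.
  by move=> h; rewrite -[leRHS]real_normK ?num_real// lerXn2r ?nnegrE// ltW.
Qed.

(** A measurable exceptional set is returned, so that later bounds combine by unions and cover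
    events whose own measurability is not known. *)
Lemma weighted_indicator_deviation (I : finType) (E : I -> set T) (p c : I -> R)
    (B eta : R) (dep : rel I) :
  (forall a, measurable (E a)) -> (forall a, P (E a) = (p a)%:E) ->
  (forall a, `|c a| <= B) ->
  (forall a b, ~~ dep a b -> P (E a `&` E b) = (p a * p b)%:E) -> 0 < eta ->
  exists A : set T, [/\ measurable A,
    forall w, ~ A w -> `|\sum_a c a * (\1_(E a) w - p a)| < eta &
    (P A <= (B ^+ 2 * (\sum_a \sum_b (dep a b)%:R) / eta ^+ 2)%:E)%E].
Proof.
move=> mE pE cB indep eta0.
pose S w := \sum_a c a * (\1_(E a) w - p a).
have p0 a : 0 <= p a by rewrite -lee_fin -pE.
have p1 a : p a <= 1 by rewrite -lee_fin -pE probability_le1.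
have mS : measurable_fun setT S.
  by apply: measurable_sum => a; apply: measurable_funM => //;
    exact: measurable_funB.
have SB w : `|S w| <= \sum_(a : I) B.
  rewrite (le_trans (ler_norm_sum _ _ _))//; apply: ler_sum => a _.
  rewrite normrM -[B]mulr1 ler_pM// indicE ler_norml.
  by have := p0 a; have := p1 a; case: (w \in E a) => /=; lra.
exists [set w | eta <= `|S w|]; split.
- by rewrite -[X in measurable X]setTI; apply: measurable_fun_le => //;
    exact: measurableT_comp.
- by move=> w /= /negP; rewrite -ltNge.
- apply: (le_trans (chebyshev_second_moment _ _ _ mS SB eta0)).
  rewrite lee_fin ler_pM2r ?invr_gt0 ?exprn_gt0//.
  exact: second_moment_bound.
Qed.

End second_moment.

(** * Riemann sums of periodic functions *)

Section riemann_sums.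
Context (R : realType).
Local Notation leb := (@lebesgue_measure R).

Definition has_modulus (g : R -> R) := forall e : R, 0 < e ->
  exists2 del : R, 0 < del & forall x y : R, `|x - y| < del -> `|g x - g y| <= e.

Lemma has_modulus_continuous (g : R -> R) : has_modulus g -> continuous g.
Proof.
move=> gm x; apply/cvgrPdist_le => e e0; have [del del0 H] := gm e e0.
near=> y; apply: H; near: y; exact: cvgr_dist_lt.
Unshelve. all: by end_near. Qed.

Lemma has_modulus_integrable (g : R -> R) (a b : R) : has_modulus g ->
  leb.-integrable `[a, b] (EFin \o g).
Proof.
move=> gm; apply: continuous_compact_integrable; first exact: segment_compact.
exact/continuous_subspaceT/has_modulus_continuous.
Qed.

Lemma Rintegral_near_cst (g : R -> R) (u v c om : R) : u <= v ->
  leb.-integrable `]u, v] (EFin \o g) ->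
  (forall x, u < x <= v -> `|g x - c| <= om) ->
  `|\int[leb]_(x in `]u, v]) g x - c * (v - u)| <= om * (v - u).
Proof.
move=> uv ig gc.
have muv : fine (leb `]u, v]%classic) = v - u.
  rewrite lebesgue_measure_itv/= lte_fin; case: ltP => //= vu.
  by apply/esym/eqP; rewrite subr_eq0 eq_le uv vu.
have mI : measurable (`]u, v]%classic : set (measurableTypeR R)).
  exact: measurable_itv.
have ic k : leb.-integrable `]u, v] (EFin \o cst k).
  have gm : has_modulus (cst k).
    by move=> e e0; exists 1 => // x y _; rewrite subrr normr0 ltW.
  apply: integrableS (has_modulus_integrable _ u v gm) => //.
  by apply: subset_itvr; rewrite bnd_simp.
have ik k : \int[leb]_(x in `]u, v]) k = k * (v - u).
  by rewrite Rintegral_cst// muv.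
have igc := integrableB mI ig (ic c).
rewrite -ik -(RintegralB mI ig (ic c)) -ik.
apply: (le_trans (le_normr_Rintegral mI igc)).
apply: (le_Rintegral mI (integrable_norm igc) (ic om)) => x /=.
by rewrite in_itv/= => xuv; exact: gc.
Qed.

(** Induction on the number of cells, at fixed mesh h = 1/(n+1). The sample point lies r <= h beyond
    the right end of its cell, hence within 2h of each point of the cell, whose error is then at
    most om h. *)
Lemma riemann_sum_approx (g : R -> R) (n m : nat) (r om : R) :
  has_modulus g -> 0 <= r <= n.+1%:R^-1 ->
  (forall x y, `|x - y| <= 2 / n.+1%:R -> `|g x - g y| <= om) ->
  `|\int[leb]_(x in `[0, m%:R / n.+1%:R]) g x
    - n.+1%:R^-1 * \sum_(1 <= i < m.+1) g (i%:R / n.+1%:R + r)|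
  <= om * (m%:R / n.+1%:R).
Proof.
move=> gm /andP[r0 rn] gom; set h := n.+1%:R^-1 in rn gom *.
have h0 : 0 < h by rewrite invr_gt0.
elim: m => [|m IH].
  rewrite big_geq// mulr0 subr0 mul0r mulr0.
  by rewrite set_itv1 Rintegral_set1 normr0.
have mh : m%:R * h <= m.+1%:R * h by rewrite ler_pM2r// ler_nat.
have mh0 : 0 <= m%:R * h by rewrite mulr_ge0// ltW.
have ig := has_modulus_integrable g 0 (m.+1%:R * h) gm.
have Iab : \int[leb]_(x in `[0, m.+1%:R * h]) g x =
    \int[leb]_(x in `[0, m%:R * h]) g x +
    \int[leb]_(x in `]m%:R * h, m.+1%:R * h]) g x.
  by rewrite -(Rintegral_itvB (x := m%:R * h) ig) ?bnd_simp// addrC subrK.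
have step : `|\int[leb]_(x in `]m%:R * h, m.+1%:R * h]) g x
    - g (m.+1%:R * h + r) * (m.+1%:R * h - m%:R * h)|
    <= om * (m.+1%:R * h - m%:R * h).
  apply: Rintegral_near_cst => //.
    apply: integrableS ig => //; apply: subset_itvr.
    by rewrite bnd_simp.
  move=> x /andP[x1 x2]; apply: gom.
  have E : m.+1%:R * h = m%:R * h + h by rewrite -natr1 mulrDl mul1r.
  by rewrite ler_norml; move: x1 x2; rewrite E; lra.
rewrite Iab big_nat_recr//= mulrDr.
have E : m.+1%:R * h - m%:R * h = h by rewrite -natr1; ring.
rewrite E in step.
have -> : om * (m.+1%:R * h) = om * (m%:R * h) + om * h by rewrite -natr1; ring.
rewrite opprD addrACA (le_trans (ler_normD _ _))// lerD//.
by rewrite (mulrC h).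
Qed.

(** A shift by one index drops the first term and appends the term one period later, which equals
    it. *)
Lemma sum_periodic_shift (n s : nat) (h : nat -> R) :
  (forall i, h (i + n)%N = h i) ->
  \sum_(1 <= i < n.+1) h (i + s)%N = \sum_(1 <= i < n.+1) h i.
Proof.
move=> hn; elim: s => [|s IH]; first by under eq_bigr do rewrite addn0.
case: n hn IH => [|n] hn IH; first by rewrite !big_geq.
rewrite -IH [RHS]big_nat_recl// [LHS]big_nat_recr//= addrC.
congr (_ + _); first by rewrite -[RHS]hn; congr h; lia.
by apply: eq_bigr => i _; rewrite addSnnS.
Qed.

Lemma periodic_int (g : R -> R) : (forall x, g (x + 1) = g x) ->
  forall (m : int) x, g (x + m%:~R) = g x.
Proof.
move=> g1; have gn n x : g (x + n%:R) = g x.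
  by elim: n x => [|n IH] x; rewrite ?addr0// -natr1 addrA g1 IH.
case=> n x; first by rewrite -pmulrn gn.
by rewrite NegzE mulrNz -pmulrn -[LHS](gn n.+1) subrK.
Qed.

(* A shift by [a] moves the grid by an integer number of steps, which merely
   permutes the terms of the sum, and a remainder [r] of less than one step. *)
Lemma riemann_sum_periodic (g : R -> R) (n : nat) (a om : R) :
  has_modulus g -> (forall x, g (x + 1) = g x) ->
  (forall x y, `|x - y| <= 2 / n.+1%:R -> `|g x - g y| <= om) ->
  `|n.+1%:R^-1 * \sum_(1 <= i < n.+2) g (i%:R / n.+1%:R - a)
    - \int[leb]_(x in `[0, 1]) g x| <= om.
Proof.
move=> gm g1 gom.
(* [t] is the fractional part of -a, [s] the number of whole mesh steps in it. *)
pose t := - a - (Num.floor (- a))%:~R.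
have t0 : 0 <= t by rewrite subr_ge0 floor_le.
pose s := Num.truncn (t * n.+1%:R); pose r := t - s%:R / n.+1%:R.
have n0 : 0 < n.+1%:R :> R by [].
have /andP[s1 s2] : s%:R <= t * n.+1%:R < s.+1%:R.
  by apply: truncn_itv; rewrite mulr_ge0.
have r_itv : 0 <= r <= n.+1%:R^-1.
  rewrite /r subr_ge0 ler_pdivrMr// s1/= lerBlDl.
  rewrite -[X in _ <= _ + X]mul1r -mulrDl ler_pdivlMr// natr1.
  exact: ltW.
have -> : \sum_(1 <= i < n.+2) g (i%:R / n.+1%:R - a) =
          \sum_(1 <= i < n.+2) g (i%:R / n.+1%:R + r).
  rewrite -(sum_periodic_shift n.+1 s (fun i => g (i%:R / n.+1%:R + r))).
    apply: eq_bigr => i _.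
    rewrite -[RHS](periodic_int g g1 (Num.floor (- a))); congr g.
    by rewrite /r /t natrD mulrDl; ring.
  by move=> i; rewrite natrD mulrDl divff ?gt_eqF// addrAC g1.
have := riemann_sum_approx g n n.+1 r om gm r_itv gom.
by rewrite divff ?gt_eqF// mulr1 distrC.
Qed.

(** The one-dimensional estimate is applied twice: to [K x] for each x, then to the partial integral
    [G], which inherits periodicity and a modulus from [K]. *)
Lemma riemann_sum_periodic2 (K : R -> R -> R) (a : R) :
  (forall x y, K (x + 1) y = K x y) -> (forall x y, K x (y + 1) = K x y) ->
  (forall e : R, 0 < e -> exists2 del : R, 0 < del & forall x y x' y',
     `|x - x'| < del -> `|y - y'| < del -> `|K x y - K x' y'| <= e) ->
  forall e : R, 0 < e -> exists N : nat, forall n, (N <= n)%N ->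
  `|n%:R^-1 * \sum_(1 <= i < n.+1) (n%:R^-1 * \sum_(1 <= j < n.+1)
       K (i%:R / n%:R - a) (j%:R / n%:R - a))
   - \int[leb]_(x in `[0, 1]) \int[leb]_(y in `[0, 1]) K x y| <= e.
Proof.
move=> K1 K2 Km e e0.
have Kx x : has_modulus (K x).
  move=> e' e'0; have [del del0 H] := Km e' e'0; exists del => // y y' yy'.
  by apply: H => //; rewrite subrr normr0.
pose G x := \int[leb]_(y in `[0, 1]) K x y.
have GE e' x x' : 0 < e' -> (forall y, `|K x y - K x' y| <= e') ->
    `|G x - G x'| <= e'.
  move=> e'0 H.
  have m01 : measurable (`[0, 1]%classic : set (measurableTypeR R)).
    exact: measurable_itv.
  have i1 := has_modulus_integrable _ 0 1 (Kx x).
  have i2 := has_modulus_integrable _ 0 1 (Kx x').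
  have ic : leb.-integrable `[0, 1] (EFin \o cst e').
    apply: has_modulus_integrable => k k0; exists 1 => // *.
    by rewrite subrr normr0 ltW.
  have iB := integrableB m01 i1 i2.
  rewrite -(RintegralB m01 i1 i2).
  apply: (le_trans (le_normr_Rintegral m01 iB)).
  apply: (le_trans (le_Rintegral m01 (integrable_norm iB) ic (fun y _ => H y))).
  have mu01 : leb `[0, 1]%classic = 1%E.
    by rewrite lebesgue_measure_itv/= lte_fin ltr01 sube0.
  by rewrite /= Rintegral_cst// [X in fine X]mu01 mulr1.
have Gm : has_modulus G.
  move=> e' e'0; have [del del0 H] := Km e' e'0; exists del => // x x' xx'.
  by apply: GE => // y; apply: H => //; rewrite subrr normr0.
have e20 : 0 < e / 2 by rewrite divr_gt0.
have [del del0 H] := Km _ e20.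
(* Beyond this index two mesh steps are shorter than [del]. *)
exists (Num.truncn (2 / del)).+1 => -[//|n] nN.
have n0 : 0 < n.+1%:R :> R by [].
have small : 2 / n.+1%:R < del.
  rewrite ltr_pdivrMr// mulrC -ltr_pdivrMr//.
  by apply: (lt_le_trans (truncnS_gt _)); rewrite ler_nat.
have inner x : `|n.+1%:R^-1 * \sum_(1 <= j < n.+2) K x (j%:R / n.+1%:R - a) - G x|
    <= e / 2.
  apply: riemann_sum_periodic => // y y' yy'; apply: H.
    by rewrite subrr normr0.
  exact: le_lt_trans small.
have outer : `|n.+1%:R^-1 * \sum_(1 <= i < n.+2) G (i%:R / n.+1%:R - a)
    - \int[leb]_(x in `[0, 1]) G x| <= e / 2.
  apply: riemann_sum_periodic => // [x|x y xy].
    by apply: eq_Rintegral => y _; rewrite K1.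
  apply: GE => // z; apply: H; last by rewrite subrr normr0.
  exact: le_lt_trans small.
(* The values of [G] at the grid points are inserted between the double sum and the double
   integral. *)
rewrite -[leLHS](_ : `|(n.+1%:R^-1 * \sum_(1 <= i < n.+2)
   (n.+1%:R^-1 * (\sum_(1 <= j < n.+2) K (i%:R / n.+1%:R - a) (j%:R / n.+1%:R - a))
     - G (i%:R / n.+1%:R - a))) +
  (n.+1%:R^-1 * \sum_(1 <= i < n.+2) G (i%:R / n.+1%:R - a)
    - \int[leb]_(x in `[0, 1]) G x)| = _); last first.
  by rewrite addrA -mulrDr -big_split/=; under eq_bigr do rewrite subrK.
rewrite (le_trans (ler_normD _ _))// [leRHS](splitr e) lerD//.
rewrite normrM ger0_norm ?invr_ge0 ?ler0n//.
rewrite ler_pdivrMl//.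
rewrite (le_trans (ler_norm_sum _ _ _))//.
apply: (le_trans (ler_sum _ (fun i _ => inner _))).
by rewrite sumr_const_nat subn1 /= mulr_natl.
Qed.

End riemann_sums.

(** * The empirical criterion *)

Section rank_objective.
Context (R : realType).
Implicit Types (f : R -> R) (Y : nat -> R).

(** This is the weighted sum of indicators to which the second moment bound applies. Ordinals start
    at 0, whence the successors in the indices of [Y]. *)
Lemma MhatE (n : nat) Y f (th : R) : Mhat n Y f th =
  \sum_(a : 'I_n * 'I_n) n%:R^-1 ^+ 2 * f (a.1.+1%:R / n%:R - th) *
    (Y a.2.+1 <= Y a.1.+1)%R%:R.
Proof.
rewrite /Mhat big_add1 big_mkord mulr_sumr.
rewrite -(pair_big predT predT (fun i j : 'I_n => n%:R^-1 ^+ 2 *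
  f (i.+1%:R / n%:R - th) * (Y j.+1 <= Y i.+1)%R%:R))/=.
apply: eq_bigr => i _; rewrite -mulr_sumr /rank.
rewrite -sum1_count big_mkcond/=.
have -> : iota 1 n = index_iota 1 n.+1 by rewrite /index_iota subn1.
by rewrite big_add1 big_mkord natr_sum; under eq_bigr do rewrite -mulrb; ring.
Qed.

Lemma rank_le (n : nat) Y i : (rank n Y i)%:R / n%:R <= 1 :> R.
Proof.
case: n => [|n]; first by rewrite invr0 mulr0.
rewrite ler_pdivrMr// mul1r ler_nat (leq_trans (count_size _ _))//.
by rewrite size_iota.
Qed.

(** The weights R_i/n lie in [0, 1] and are averaged, so the constant of [f] serves for every sample
    and every n. For n = 0 the criterion is 0, as the inverse of 0 is 0. *)
Lemma Mhat_lipschitz (n : nat) Y f (L : R) :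
  (forall x y, `|f x - f y| <= L * `|x - y|) ->
  forall th th', `|Mhat n Y f th - Mhat n Y f th'| <= L * `|th - th'|.
Proof.
move=> fL th th'; have L0 : 0 <= L.
  by have := fL 1 0; rewrite subr0 normr1 mulr1; apply: le_trans.
case: n => [|n]; first by rewrite /Mhat !invr0 !mul0r subrr normr0 mulr_ge0.
rewrite /Mhat -mulrBr -sumrB normrM ger0_norm ?invr_ge0 ?ler0n// ler_pdivrMl//.
rewrite (le_trans (ler_norm_sum _ _ _))//.
apply: (@le_trans _ _ (\sum_(1 <= i < n.+2) L * `|th - th'|)); last first.
  by rewrite sumr_const_nat subn1 /= mulr_natl.
apply: ler_sum => i _; rewrite -mulrBr normrM ger0_norm ?divr_ge0 ?ler0n//.
rewrite -[leRHS]mul1r ler_pM ?divr_ge0 ?ler0n ?rank_le//.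
apply: (le_trans (fL _ _)).
by rewrite opprD addrACA subrr add0r opprK addrC distrC.
Qed.

Lemma Mhat_periodic (n : nat) Y f : (forall x, f (x + 1) = f x) ->
  forall th, Mhat n Y f (th + 1) = Mhat n Y f th.
Proof.
move=> f1 th; congr (_ * _); apply: eq_bigr => i _.
by rewrite -[in RHS](subrK 1 (i%:R / n%:R - th)) f1 opprD addrA.
Qed.

End rank_objective.

(** Four indices that are not all distinct satisfy one of 6 equalities, and each equality holds for
    n^3 quadruples. *)
Lemma sum_dependent_pairs (R : realType) (n : nat) :
  \sum_(a : 'I_n * 'I_n) \sum_(b : 'I_n * 'I_n)
    (~~ uniq [:: a.1; a.2; b.1; b.2])%:R <= 6%:R * n%:R ^+ 3 :> R.
Proof.
have H (x y z t : 'I_n) : (~~ uniq [:: x; y; z; t] <=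
   (x == y) + (x == z) + (x == t) + (y == z) + (y == t) + (z == t))%N.
  rewrite /= !inE.
  by case: (x == y); case: (x == z); case: (x == t); case: (y == z);
     case: (y == t); case: (z == t).
have S (x : 'I_n) : (\sum_(y < n) (x == y) = 1)%N.
  by rewrite (bigD1 x)//= eqxx big1// => i /negbTE; rewrite eq_sym => ->.
have inner (x y : 'I_n) : (\sum_(z < n) \sum_(t < n)
    ((x == y) + (x == z) + (x == t) + (y == z) + (y == t) + (z == t)) =
    (x == y) * (n * n) + 5 * n)%N.
  under eq_bigr => z _ do
    rewrite !big_split/= !S !sum_nat_const card_ord.
  rewrite !big_split/= -!big_distrr/= !S !sum_nat_const card_ord.
  by lia.
rewrite -natrX -natrM; under eq_bigr do rewrite -natr_sum.
rewrite -natr_sum ler_nat.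
apply: (@leq_trans (\sum_(x < n) \sum_(y < n) ((x == y) * (n * n) + 5 * n))%N).
  rewrite [leqRHS]pair_big/=; apply: leq_sum => -[x y] _.
  rewrite -inner [leqRHS]pair_big/=.
  by apply: leq_sum => -[z t] _; exact: H.
under eq_bigr => x _ do
  rewrite big_split/= -big_distrl/= S sum_nat_const card_ord.
rewrite sum_nat_const card_ord; lia.
Qed.

(** * The population criterion *)

Section population_objective.
Context (R : realType) (phi f : R -> R) (thstar L B : R).
Context (nu : probability (measurableTypeR R) R).
Hypothesis phi_ge0 : forall x, 0 <= phi x.
Hypothesis mphi : measurable_fun [set: R] phi.
Hypothesis nuE : forall A : set R, measurable A ->
  nu A = (\int[@lebesgue_measure R]_(x in A) (phi x)%:E)%E.
Hypothesis fL : forall x y, `|f x - f y| <= L * `|x - y|.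
Hypothesis f1 : forall x, f (x + 1) = f x.
Hypothesis fB : forall x, `|f x| <= B.

Let L_ge0 : 0 <= L.
Proof. by have := fL 1 0; rewrite subr0 normr1 mulr1; apply: le_trans. Qed.

Let B_ge0 : 0 <= B. Proof. exact: le_trans (fB 0). Qed.

Let Phi2nn c : 0 <= Phi2 phi c. Proof. exact: (Phi2_ge0 _ _ mphi nu nuE). Qed.

Let Phi2le c : Phi2 phi c <= 1. Proof. exact: (Phi2_le1 _ _ mphi nu nuE). Qed.

(** The mean of [Mhat], except that the diagonal probabilities 1 are replaced by Phi_2(0); also the
    Riemann sum for [Mpop] on the grid shifted by [thstar]. *)
Definition Mriemann (n : nat) (th : R) : R :=
  n%:R^-1 * \sum_(1 <= i < n.+1) (n%:R^-1 * \sum_(1 <= j < n.+1)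
    (Phi2 phi (f (i%:R / n%:R - thstar) - f (j%:R / n%:R - thstar))
     * f (i%:R / n%:R - th))).

Lemma Mriemann_cvg (th e : R) : 0 < e -> exists N : nat, forall n, (N <= n)%N ->
  `|Mriemann n th - Mpop phi f thstar th| <= e.
Proof.
pose K x y := Phi2 phi (f x - f y) * f (x + thstar - th).
have K1 x y : K (x + 1) y = K x y.
  by rewrite /K f1 -!addrA (addrC 1) !addrA f1.
have K2 x y : K x (y + 1) = K x y by rewrite /K f1.
have Km : forall e : R, 0 < e -> exists2 del : R, 0 < del & forall x y x' y',
    `|x - x'| < del -> `|y - y'| < del -> `|K x y - K x' y'| <= e.
  move=> e' e'0.
  have B1 : 0 < B + 1 by rewrite ltr_pwDr.
  have L1 : 0 < L + 1 by rewrite ltr_pwDr.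
  have e1 : 0 < e' / 2 / (B + 1) by rewrite !divr_gt0.
  have [del del0 H] := Phi2_modulus _ _ phi_ge0 mphi nu nuE _ e1.
  (* The first bound keeps the difference of the two values of [f] inside [Phi2] within [del], the
     second controls the outer factor [f]. Adding 1 to [L] and [B] avoids division by 0. *)
  exists (Num.min (del / 2 / (L + 1)) (e' / 2 / (L + 1))).
    by rewrite lt_min !divr_gt0.
  move=> x y x' y'; rewrite !lt_min => /andP[x1 x2] /andP[y1 _].
  have fLe u v k : `|u - v| < k / (L + 1) -> `|f u - f v| < k.
    rewrite ltr_pdivlMr// mulrDr mulr1 => uvk.
    by apply: le_lt_trans (fL u v) _; have := normr_ge0 (u - v); lra.
  have PP : `|Phi2 phi (f x - f y) - Phi2 phi (f x' - f y')| <= e' / 2 / (B + 1).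
    apply: H.
    rewrite (_ : _ - _ = (f x - f x') - (f y - f y')); last by ring.
    rewrite (le_lt_trans (ler_normB _ _))// [ltRHS]splitr.
    by rewrite ltrD// fLe.
  have -> : K x y - K x' y' =
    (Phi2 phi (f x - f y) - Phi2 phi (f x' - f y')) * f (x + thstar - th) +
    Phi2 phi (f x' - f y') * (f (x + thstar - th) - f (x' + thstar - th)).
    (* [ring] would compare the atoms by unfolding the integrals *)
    rewrite /K; move: (Phi2 _ _) (Phi2 _ _) (f (x + _ - _)) (f (x' + _ - _)).
    by move=> p p' q q'; ring.
  rewrite (le_trans (ler_normD _ _))// [leRHS]splitr lerD//.
    rewrite normrM (le_trans (ler_pM _ _ PP (fB _)))// mulrAC ler_pdivrMr//.
    by rewrite ler_pM2l ?divr_gt0// lerDl.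
  rewrite normrM -[leRHS]mul1r ler_pM//.
    by rewrite ger0_norm.
  by apply/ltW/fLe; rewrite (_ : _ - _ = x - x') //; ring.
move=> e0; have [N HN] := riemann_sum_periodic2 _ K thstar K1 K2 Km e e0.
exists N => n /HN; rewrite /Mriemann.
under eq_bigr do under eq_bigr do rewrite /K subrK.
by [].
Qed.

Lemma Mriemann_lipschitz (n : nat) (th th' : R) :
  `|Mriemann n th - Mriemann n th'| <= L * `|th - th'|.
Proof.
case: n => [|n]; first by rewrite /Mriemann !invr0 !mul0r subrr normr0 mulr_ge0.
have n0 : 0 < n.+1%:R :> R by [].
rewrite /Mriemann -mulrBr -sumrB normrM ger0_norm ?invr_ge0 ?ler0n// ler_pdivrMl//.
rewrite (le_trans (ler_norm_sum _ _ _))//.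
apply: (@le_trans _ _ (\sum_(1 <= i < n.+2) L * `|th - th'|)); last first.
  by rewrite sumr_const_nat subn1 /= mulr_natl.
apply: ler_sum => i _.
rewrite -mulrBr -sumrB normrM ger0_norm ?invr_ge0 ?ler0n// ler_pdivrMl//.
rewrite (le_trans (ler_norm_sum _ _ _))//.
apply: (@le_trans _ _ (\sum_(1 <= i < n.+2) L * `|th - th'|)); last first.
  by rewrite sumr_const_nat subn1 /= mulr_natl.
apply: ler_sum => j _.
rewrite -mulrBr normrM ger0_norm ?Phi2nn//.
rewrite -[leRHS]mul1r ler_pM//.
apply: (le_trans (fL _ _)).
by rewrite opprD addrACA subrr add0r opprK addrC distrC.
Qed.

(** The Lipschitz bound of the Riemann sums passes to their pointwise limit, so the double integral
    itself need not be estimated. *)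
Lemma Mpop_lipschitz (th th' : R) :
  `|Mpop phi f thstar th - Mpop phi f thstar th'| <= L * `|th - th'|.
Proof.
apply/ler_addgt0Pr => e e0.
have e2 : 0 < e / 2 by rewrite divr_gt0.
have [N HN] := Mriemann_cvg th _ e2; have [N' HN'] := Mriemann_cvg th' _ e2.
have := HN (maxn N N') (leq_maxl _ _); have := HN' (maxn N N') (leq_maxr _ _).
have := Mriemann_lipschitz (maxn N N') th th'.
move: (Mriemann _ th) (Mriemann _ th') (Mpop phi f _ th) (Mpop phi f _ th').
by move=> a a' b b'; rewrite !ler_norml; lra.
Qed.

Lemma Mpop_periodic (th : R) : Mpop phi f thstar (th + 1) = Mpop phi f thstar th.
Proof.
apply: eq_Rintegral => x _; apply: eq_Rintegral => y _; congr (_ * _).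
by rewrite -[in RHS](subrK 1 (x + thstar - th)) f1 opprD addrA.
Qed.

End population_objective.

(** * Convergence of the empirical criterion *)

Lemma div_natr_lt (R : realType) (c e : R) : 0 < e ->
  exists N : nat, forall n, (N <= n)%N -> (0 < n)%N /\ c / n%:R < e.
Proof.
move=> e0; exists (Num.truncn (`|c| / e)).+1 => n Nn.
have n0 : (0 < n)%N by exact: leq_trans Nn.
split=> //; rewrite ltr_pdivrMr ?ltr0n// mulrC -ltr_pdivrMr//.
apply: (@le_lt_trans _ _ (`|c| / e)); first by rewrite ler_pM2r ?invr_gt0 ?ler_norm.
by apply: (lt_le_trans (truncnS_gt _)); rewrite ler_nat.
Qed.

Section weak_law.
Context (d : measure_display) (T : measurableType d) (R : realType).
Context (P : probability T R) (phi f : R -> R) (thstar L B : R).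
Context (Z : nat -> nat -> {mfun T >-> measurableTypeR R}).
Hypothesis phi_ge0 : forall x, 0 <= phi x.
Hypothesis mphi : measurable_fun [set: R] phi.
Hypothesis Zlaw : forall n i (A : set R), (1 <= i <= n)%N -> measurable A ->
  P (Z n i @^-1` A) = (\int[@lebesgue_measure R]_(x in A) (phi x)%:E)%E.
Hypothesis Zindep : forall n (A : nat -> set (measurableTypeR R)),
  (forall i, measurable (A i)) ->
  P [set w | forall i, (1 <= i <= n)%N -> Z n i w \in A i] =
  (\prod_(1 <= i < n.+1) P (Z n i @^-1` A i))%E.
Hypothesis fL : forall x y, `|f x - f y| <= L * `|x - y|.
Hypothesis f1 : forall x, f (x + 1) = f x.
Hypothesis fB : forall x, `|f x| <= B.

(** The noise-free value of Y_i, not the design point i/n. *)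
Let x_ n i : R := f (i%:R / n%:R - thstar).
Let Y n w i := x_ n i + Z n i w.
Let nu : probability (measurableTypeR R) R := distribution P (Z 1 1).
Let nuE (A : set R) : measurable A ->
  nu A = (\int[@lebesgue_measure R]_(x in A) (phi x)%:E)%E.
Proof. by move=> mA; apply: Zlaw. Qed.

(* Phi2 phi 0 is not the probability of {Y_i <= Y_i}, hence the special case of
   the diagonal, which contributes O(1/n). *)
Let prob n (a : 'I_n * 'I_n) : R :=
  if a.1 == a.2 then 1 else Phi2 phi (x_ n a.1.+1 - x_ n a.2.+1).

Let coef n th (a : 'I_n * 'I_n) : R := n%:R^-1 ^+ 2 * f (a.1.+1%:R / n%:R - th).

(** Only the n diagonal terms differ, each by at most B/n^2, because 1 - Phi_2(0) lies in [0, 1]. *)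
Let center_Mriemann n th :
  `|\sum_a coef n th a * prob n a - Mriemann R phi f thstar n th| <= B / n%:R.
Proof.
have -> : Mriemann R phi f thstar n th = \sum_(a : 'I_n * 'I_n)
    coef n th a * Phi2 phi (x_ n a.1.+1 - x_ n a.2.+1).
  rewrite /Mriemann big_add1 big_mkord mulr_sumr.
  rewrite -(pair_big predT predT (fun i j : 'I_n => coef n th (i, j) *
     Phi2 phi (x_ n i.+1 - x_ n j.+1)))/=.
  apply: eq_bigr => i _; rewrite big_add1 big_mkord mulrA mulr_sumr.
  by apply: eq_bigr => j _; rewrite /coef /x_ /=; ring.
rewrite -sumrB (le_trans (ler_norm_sum _ _ _))//.
apply: (@le_trans _ _ (\sum_(i < n) \sum_(j < n) n%:R^-1 ^+ 2 * B * (i == j)%:R)).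
  rewrite pair_big/=; apply: ler_sum => -[i j] _ /=; rewrite -mulrBr normrM.
  rewrite ler_pM//.
    by rewrite normrM ger0_norm ?sqr_ge0// ler_wpM2l ?sqr_ge0.
  rewrite /prob /=; case: eqP => _; last by rewrite subrr normr0.
  have := Phi2_ge0 _ _ mphi nu nuE (x_ n i.+1 - x_ n j.+1).
  have := Phi2_le1 _ _ mphi nu nuE (x_ n i.+1 - x_ n j.+1).
  by rewrite mulr1n ler_norml; lra.
under eq_bigr => i _.
  rewrite -mulr_sumr (bigD1 i)//= eqxx big1 => [|j /negbTE]; last first.
    by rewrite eq_sym => ->.
  rewrite addr0 mulr1; over.
rewrite sumr_const card_ord -[_ *+ n]mulr_natr.
case: n => [|n]; first by rewrite !mulr0 invr0 mulr0.
have k0 : n.+1%:R != 0 :> R by [].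
move: (n.+1%:R) k0 => k k0; rewrite le_eqVlt; apply/orP; left; apply/eqP.
by field.
Qed.

Let mhalf c : measurable
  [set p : measurableTypeR R * measurableTypeR R | p.2 <= c + p.1].
Proof.
rewrite -[X in measurable X]setTI.
apply: (@measurable_fun_le _ _ _ setT snd (fun p => c + p.1)) => //.
exact: measurable_funD.
Qed.

(** The coefficients are at most B/n^2 and at most 6 n^3 pairs of events are dependent, so the
    second moment is at most 6 B^2/n. *)
Lemma Mhat_deviation n th eta : (0 < n)%N -> 0 < eta ->
  exists A : set T, [/\ measurable A,
    forall w, ~ A w ->
      `|Mhat n (Y n w) f th - Mriemann R phi f thstar n th| < eta + B / n%:R &
    (P A <= (6 * B ^+ 2 / eta ^+ 2 / n%:R)%:E)%E].
Proof.
move=> n0 eta0.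
have nR0 : 0 < n%:R :> R by rewrite ltr0n.
pose E (a : 'I_n * 'I_n) : set T := (fun w => (Z n a.1.+1 w, Z n a.2.+1 w)) @^-1`
  [set p : measurableTypeR R * measurableTypeR R |
    p.2 <= (x_ n a.1.+1 - x_ n a.2.+1) + p.1].
have YE (a : 'I_n * 'I_n) w : (Y n w a.2.+1 <= Y n w a.1.+1)%R = (w \in E a).
  by apply/idP/idP => [h|]; rewrite inE /E /= /Y => *; [move: h; rewrite /Y|]; lra.
have mE a : measurable (E a) by apply: measurable_pair_preimage; exact: mhalf.
have rng (i : 'I_n) : (1 <= i.+1 <= n)%N by rewrite /= ltn_ord.
have PE a : P (E a) = (prob n a)%:E.
  case: a => i j; rewrite /prob /=; case: ifPn => [/eqP ->|ij].
    rewrite (_ : E _ = setT) ?probability_setT//; apply/seteqP; split=> // w _.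
    by rewrite /E /= subrr add0r.
  rewrite /E /= (independent_pair_law _ _ _ P _ _ n (Z n) (Zindep n))//.
    by apply: product_halfplane_Phi2 => // A mA; exact: Zlaw.
have coefB a : `|coef n th a| <= n%:R^-1 ^+ 2 * B.
  by rewrite normrM ger0_norm ?sqr_ge0// ler_wpM2l ?sqr_ge0.
(* Two events count as dependent as soon as an index is repeated among the four, so diagonal events
   always do. *)
have dis a b : ~~ (~~ uniq [:: a.1; a.2; b.1; b.2]) ->
    P (E a `&` E b) = (prob n a * prob n b)%:E.
  rewrite negbK => u.
  rewrite (independent_disjoint_pairs _ _ _ P _ _ n (Z n) (Zindep n))//.
  by rewrite -/(E a) -/(E b) !PE.
have [A [mA HA PA]] := weighted_indicator_deviation _ _ _ P _ E (prob n)
  (coef n th) _ eta (fun a b => ~~ uniq [:: a.1; a.2; b.1; b.2])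
  mE PE coefB dis eta0.
exists A; split => //.
  move=> w /HA wA; have := center_Mriemann n th.
  have -> : Mhat n (Y n w) f th = \sum_a coef n th a * \1_(E a) w.
    by rewrite MhatE; apply: eq_bigr => a _; rewrite YE indicE.
  move: wA; under eq_bigr do rewrite mulrBr.
  by rewrite sumrB ltr_norml ler_norml ltr_norml; lra.
apply: (le_trans PA); rewrite lee_fin.
rewrite [leRHS]mulrAC ler_pM2r ?invr_gt0 ?exprn_gt0//.
have Dn := sum_dependent_pairs R n.
apply: (@le_trans _ _ ((n%:R^-1 ^+ 2 * B) ^+ 2 * (6 * n%:R ^+ 3))).
  by rewrite ler_wpM2l ?sqr_ge0.
rewrite le_eqVlt; apply/orP; left; apply/eqP; field.
by rewrite gt_eqF.
Qed.

Lemma Mhat_pointwise_cvg th eta delta : 0 < eta -> 0 < delta ->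
  exists N : nat, forall n, (N <= n)%N -> exists A : set T, [/\ measurable A,
    forall w, ~ A w -> `|Mhat n (Y n w) f th - Mpop phi f thstar th| <= eta &
    (P A < delta%:E)%E].
Proof.
(* The three thirds are for the Riemann sum error, the diagonal and the random fluctuation. *)
move=> eta0 delta0; have e3 : 0 < eta / 3 by rewrite divr_gt0.
have [N1 H1] := Mriemann_cvg _ _ _ thstar _ _ nu phi_ge0 mphi nuE fL f1 fB th _ e3.
have [N2 H2] := div_natr_lt _ B _ e3.
have [N3 H3] := div_natr_lt _ (6 * B ^+ 2 / (eta / 3) ^+ 2) _ delta0.
exists (maxn N1 (maxn N2 N3)) => n; rewrite !geq_max.
move=> /and3P[/H1 h1 /H2[n0 h2] /H3[_ h3]].
have [A [mA HA PA]] := Mhat_deviation n th _ n0 e3.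
exists A; split => //; last by apply: (le_lt_trans PA); rewrite lte_fin.
by move=> w /HA; move: h1 h2; rewrite !ler_norml !ltr_norml; lra.
Qed.

Lemma Mhat_finite_cvg (s : seq R) eta delta : 0 < eta -> 0 < delta ->
  exists N : nat, forall n, (N <= n)%N -> exists A : set T, [/\ measurable A,
    forall w, ~ A w -> {in s, forall th,
      `|Mhat n (Y n w) f th - Mpop phi f thstar th| <= eta} &
    (P A < delta%:E)%E].
Proof.
move=> eta0; elim: s delta => [|th s IH] delta delta0.
  by exists 0 => n _; exists set0; split; rewrite ?measure0.
have d2 : 0 < delta / 2 by rewrite divr_gt0.
have [N1 H1] := IH _ d2; have [N2 H2] := Mhat_pointwise_cvg th _ _ eta0 d2.
exists (maxn N1 N2) => n; rewrite geq_max => /andP[/H1 + /H2].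
move=> [A [mA HA PA]] [A' [mA' HA' PA']].
exists (A `|` A'); split; first exact: measurableU.
  move=> w /not_orP[/HA hA /HA' hA'] t.
  by rewrite inE => /predU1P[->//|/hA].
apply: (le_lt_trans (measureU2 P mA mA')).
by rewrite (splitr delta) EFinD lteD.
Qed.

(** After reduction modulo 1, theta lies within 1/k of a point of the net, where L/k < eta/3. Each
    criterion moves by at most eta/3 between the two points, and the last third is the error on the
    net. *)
Lemma Mhat_uniform_cvg eta delta : 0 < eta -> 0 < delta ->
  exists N : nat, forall n, (N <= n)%N -> exists A : set T, [/\ measurable A,
    forall w, ~ A w -> forall th,
      `|Mhat n (Y n w) f th - Mpop phi f thstar th| <= eta &
    (P A < delta%:E)%E].
Proof.
move=> eta0 delta0; have e3 : 0 < eta / 3 by rewrite divr_gt0.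
have [k /(_ _ (leqnn k))[k0 Lk]] := div_natr_lt _ L _ e3.
have kR0 : 0 < k%:R :> R by rewrite ltr0n.
have L0 : 0 <= L by have := fL 1 0; rewrite subr0 normr1 mulr1; apply: le_trans.
have [N HN] := Mhat_finite_cvg [seq i%:R / k%:R | i <- iota 0 k] _ _ e3 delta0.
exists N => n /HN[A [mA HA PA]]; exists A; split => // w /HA {}HA th.
pose u := th - (Num.floor th)%:~R.
have u0 : 0 <= u by rewrite subr_ge0 floor_le.
have u1 : u < 1 by rewrite ltrBlDl -intrD1 floorD1_gt.
have -> : th = u + (Num.floor th)%:~R by rewrite subrK.
rewrite (periodic_int _ _ (Mhat_periodic _ n (Y n w) f f1)).
rewrite (periodic_int _ _ (Mpop_periodic _ phi f thstar f1)).
pose i := Num.truncn (u * k%:R).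
have /andP[i1 i2] : i%:R <= u * k%:R < i.+1%:R.
  by apply: truncn_itv; rewrite mulr_ge0// ltW.
have ik : (i < k)%N.
  by rewrite -(ltr_nat R) (le_lt_trans i1)// gtr_pMl.
have ui : `|u - i%:R / k%:R| <= k%:R^-1.
  rewrite ger0_norm ?subr_ge0 ?ler_pdivrMr// lerBlDl -[X in _ + X]mul1r -mulrDl.
  by rewrite natr1 ler_pdivlMr// ltW.
have Lui : L * `|u - i%:R / k%:R| <= eta / 3.
  by rewrite (le_trans _ (ltW Lk))// ler_wpM2l.
have hi : (i%:R / k%:R : R) \in [seq j%:R / k%:R | j <- iota 0 k].
  by apply: (map_f (fun j : nat => j%:R / k%:R : R)); rewrite mem_iota.
have := HA _ hi.
have := le_trans (Mhat_lipschitz _ n (Y n w) f L fL u (i%:R / k%:R)) Lui.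
have MLip := Mpop_lipschitz _ _ _ thstar _ _ nu phi_ge0 mphi nuE fL f1 fB.
have := le_trans (MLip u (i%:R / k%:R)) Lui.
move: (Mhat _ _ f u) (Mpop phi f _ u) => a b.
move: (Mhat _ _ f _) (Mpop phi f _ _) => a' b'.
by rewrite !ler_norml; lra.
Qed.

End weak_law.

(** * Separation of the maximum and consistency *)

(** Modulo 1, the points farther than eps from [thstar] fall in the compact interval
    [thstar + eps, thstar + 1 - eps]. The maximum of M there is attained, and uniqueness puts it
    strictly below M(thstar). *)
Lemma Mpop_gap (R : realType) (phi f : R -> R) (thstar eps : R) :
  continuous (Mpop phi f thstar) -> (forall x, f (x + 1) = f x) -> 0 < eps ->
  (forall th, circ_dist th thstar != 0 ->
     Mpop phi f thstar th < Mpop phi f thstar thstar) ->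
  exists2 gap : R, 0 < gap & forall th, eps < circ_dist th thstar ->
    Mpop phi f thstar th <= Mpop phi f thstar thstar - gap.
Proof.
move=> Mc f1 eps0 Mmax; set M := Mpop phi f thstar in Mc Mmax *.
(* Circular distances never exceed 1/2, so for larger eps there is no such point and any gap will
   do. *)
have [eps1|eps1] := ltP (1 - eps) eps.
  exists 1 => // th; rewrite /circ_dist lt_min => /andP[h1 h2].
  by exfalso; lra.
have le_ab : thstar + eps <= thstar + (1 - eps) by rewrite lerD2l.
have [c cI cmax] := EVT_max le_ab (continuous_subspaceT Mc).
have cM : M c < M thstar.
  apply: Mmax; move: cI; rewrite in_itv/= => /andP[c1 c2].
  have fl0 : Num.floor (c - thstar) = 0.
    by apply: floor_def; rewrite mulr0z add0r mulr1z; apply/andP; split; lra.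
  rewrite /circ_dist fl0 subr0 gt_eqF// lt_min.
  by apply/andP; split; lra.
exists (M thstar - M c) => [|th]; first by rewrite subr_gt0.
rewrite /circ_dist; set t := th - thstar - _; rewrite lt_min => /andP[t1 t2].
have -> : th = thstar + t + (Num.floor (th - thstar))%:~R by rewrite /t; ring.
rewrite /M (periodic_int _ _ (Mpop_periodic _ phi f thstar f1)) -/M.
rewrite subKr; apply: cmax; rewrite in_itv/=.
by clear - t1 t2; apply/andP; split; lra.
Qed.

Theorem theorem1 (R : realType) (d : measure_display) (T : measurableType d)
  (P : probability T R)
  (f : R -> R) (phi : R -> R) (thstar : R)
  (Z : nat -> nat -> T -> R) (thhat : nat -> T -> R) :
  (* f Lipschitz *)
  (exists L : R, forall x y, `|f x - f y| <= L * `|x - y|) ->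
  (* f 1-periodic *)
  (forall x, f (x + 1) = f x) ->
  (* f exactly 1-periodic *)
  (forall th1 th2 : R, circ_dist th1 th2 != 0 ->
     (0%E < (@lebesgue_measure R) [set x : R | (f (x - th1) <> f (x - th2))%R])%E) ->
  (* phi is an even probability density *)
  measurable_fun [set: R] phi ->
  (forall x, 0 <= phi x) ->
  (forall x, phi (- x) = phi x) ->
  (* for each n, Z_{n,1}, ..., Z_{n,n} are random variables with density phi *)
  (forall n i, measurable_fun [set: T] (Z n i)) ->
  (forall n i (B : set R), (1 <= i <= n)%N -> measurable B ->
     P (Z n i @^-1` B) = (\int[(@lebesgue_measure R)]_(x in B) (phi x)%:E)%E) ->
  (* ... and mutually independent *)
  (forall n (B : nat -> set R), (forall i, measurable (B i)) ->
     P [set w | forall i, (1 <= i <= n)%N -> Z n i w \in B i] =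
     (\prod_(1 <= i < n.+1) P (Z n i @^-1` B i))%E) ->
  (* theta* is the unique maximiser of M modulo 1 *)
  (forall th, circ_dist th thstar != 0 ->
     Mpop phi f thstar th < Mpop phi f thstar thstar) ->
  (* thhat n w maximises hat M_n for the observations Y_i = f(i/n - thstar) + Z_{n,i} *)
  (forall n w th,
     let Y := fun i => f (i%:R / n%:R - thstar) + Z n i w in
     Mhat n Y f th <= Mhat n Y f (thhat n w)) ->
  (* conclusion: thhat_n -> theta* in (outer) probability, modulo 1 *)
  forall eps delta : R, 0 < eps -> 0 < delta ->
  exists N : nat, forall n, (N <= n)%N ->
    exists A : set T, measurable A /\
      [set w | eps < circ_dist (thhat n w) thstar] `<=` A /\
      (P A < delta%:E)%E.
Proof.
move=> [L0 fL0] f1 _ mphi phi_ge0 _ mZ Zlaw Zindep Mmax Hhat.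
move=> eps delta eps0 delta0.
pose L := `|L0|; have L_ge0 : 0 <= L by exact: normr_ge0.
have fL x y : `|f x - f y| <= L * `|x - y|.
  by apply: (le_trans (fL0 x y)); rewrite ler_wpM2r// ler_norm.
(* By periodicity it is enough to bound [f] on [0, 1), where it is within [L] of f(0). *)
pose B := `|f 0| + L.
have fB x : `|f x| <= B.
  have -> : f x = f (x - (Num.floor x)%:~R).
    by rewrite -[in LHS](subrK (Num.floor x)%:~R x) (periodic_int _ _ f1).
  have u0 : 0 <= x - (Num.floor x)%:~R by rewrite subr_ge0 floor_le.
  have u1 : x - (Num.floor x)%:~R < 1 by rewrite ltrBlDl -intrD1 floorD1_gt.
  move: (x - _) u0 u1 => u u0 u1.
  have := fL u 0; rewrite subr0 (ger0_norm u0) => h.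
  rewrite -[f u](subrK (f 0)) addrC (le_trans (ler_normD _ _))// lerD2l.
  by apply: (le_trans h); apply: ler_piMr => //; exact: ltW.
pose X n i : {mfun T >-> measurableTypeR R} :=
  HB.pack (Z n i) (isMeasurableFun.Build _ _ _ _
    (Z n i : T -> measurableTypeR R) (mZ n i)).
pose nu : probability (measurableTypeR R) R := distribution P (X 1 1).
have nuE (A : set R) : measurable A ->
    nu A = (\int[@lebesgue_measure R]_(x in A) (phi x)%:E)%E.
  by move=> mA; apply: Zlaw.
have Mm : has_modulus R (Mpop phi f thstar).
  move=> e e0; exists (e / (L + 1)); first by rewrite divr_gt0// ltr_pwDr.
  move=> x y; rewrite ltr_pdivlMr ?ltr_pwDr// mulrDr mulr1 mulrC => xy.
  have MLip := Mpop_lipschitz _ _ _ thstar _ _ nu phi_ge0 mphi nuE fL f1 fB.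
  apply: (le_trans (MLip x y)).
  by have := normr_ge0 (x - y); lra.
have Mc := has_modulus_continuous _ _ Mm.
have [gap gap0 Hgap] := Mpop_gap _ _ _ _ _ Mc f1 eps0 Mmax.
(* With uniform error gap/4, M(thhat) >= Mhat(thhat) - gap/4 >= Mhat(thstar) - gap/4 >= M(thstar) -
   gap/2, which is incompatible with a drop by the full gap. *)
have g4 : 0 < gap / 4 by rewrite divr_gt0.
have [N HN] := Mhat_uniform_cvg _ _ _ P phi f thstar L B X phi_ge0 mphi
  Zlaw Zindep fL f1 fB _ _ g4 delta0.
exists N => n /HN[A [mA HA PA]]; exists A; split => //; split => // w /= /Hgap hgap.
apply: contrapT => /HA {}HA.
have := HA thstar; have := HA (thhat n w); have := Hhat n w thstar.
move: hgap => /=; move: (Mhat _ _ _ thstar) (Mpop _ _ _ thstar) => a b.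
by move: (Mhat _ _ _ _) (Mpop _ _ _ _) => a' b'; rewrite !ler_norml; lra.
Qed.
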